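(* Let $G$ be a finite abelian group of order $n$, let $\mathrm{Irr}(G)=\{\chi_1,\ldots,\chi_n\}$, where $\chi_1$ is the trivial character of $G$, let $\Gamma=\mathrm{SC}(G,R,L,S)$ be a semi-Cayley graph over $G$, and let $X=\{i\mid \chi_i(S)=0,\ 1\le i\le n\}$. Let $u=(g,r)$ and $v=(h,s)$ be two vertices of $\Gamma$ (with $g,h\in G$ and $r,s\in\{0,1\}$) and let $a=g^{-1}h$. Let $\lambda_i^{\pm}$ be the numbers defined in the context. Then $\Gamma$ has a PST from $u$ to $v$ at time $t$ if and only if one of the following holds: (1) $r=s=0$, $\chi_i(a)=\exp(-\mathbf{i}(\lambda_1^+-\lambda_i^+)t)$ for all $i=1,\ldots,n$, and $\chi_j(a)=\exp(-\mathbf{i}(\lambda_1^+-\lambda_j^-)t)$ for all $j\notin X$; (2) $r=s=1$, $\chi_i(a)=\exp(-\mathbf{i}(\lambda_1^--\lambda_i^-)t)$ for all $i=1,\ldots,n$, and $\chi_j(a)=\exp(-\mathbf{i}(\lambda_1^--\lambda_j^+)t)$ for all $j\notin X$; (3) $r=0$, $s=1$, $X=\emptyset$, for all $j=1,\ldots,n$ $$\chi_j(a)=\frac{|\chi_j(S)|}{\chi_j(S)}\exp(-\mathbf{i}(\lambda_1^+-\lambda_j^+)t),\qquad \exp(-\mathbf{i}\lambda_j^+t)=-\exp(-\mathbf{i}\lambda_j^-t),$$ and $R=L$; (4) $r=1$, $s=0$, $X=\emptyset$, for all $j=1,\ldots,n$ $$\chi_j(a)=\frac{|\chi_j(S)|}{\overline{\chi_j(S)}}\exp(-\mathbf{i}(\lambda_1^+-\lambda_j^+)t),\qquad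 \exp(-\mathbf{i}\lambda_j^+t)=-\exp(-\mathbf{i}\lambda_j^-t),$$ and $R=L$.
   Context: Here $\mathbf{i}=\sqrt{-1}$. Graphs are finite, simple and undirected; groups are finite. Semi-Cayley graph: let $G$ be a finite group and $R,L,S\subseteq G$ with $R=R^{-1}$, $L=L^{-1}$ and $1\notin R\cup L$. $\mathrm{SC}(G,R,L,S)$ is the undirected graph with vertex set $\{(g,0),(g,1)\mid g\in G\}$ and edges $\{(x,0),(y,0)\}$ with $yx^{-1}\in R$, $\{(x,1),(y,1)\}$ with $yx^{-1}\in L$, and $\{(x,0),(y,1)\}$ with $yx^{-1}\in S$. PST: for a graph with adjacency matrix $A$, put $H(t)=\exp(-\mathbf{i}tA)$ for real $t>0$. The graph has a perfect state transfer (PST) from vertex $u$ to vertex $v$ at time $t$ if $|H_{u,v}(t)|=1$. $\mathrm{Irr}(G)$ is the set of complex irreducible characters of $G$ (homomorphisms $G\to\mathbb{C}^\times$ when $G$ is abelian). For $Y\subseteq G$, $\chi(Y)=\sum_{y\in Y}\chi(y)$, with $\chi(\emptyset)=0$. For $1\le i\le n$: if $\chi_i(S)\neq 0$ then $$\lambda_i^{\pm}=\tfrac12\Big(\chi_i(R)+\chi_i(L)\pm\sqrt{(\chi_i(R)-\chi_i(L))^2+4|\chi_i(S)|^2}\Big),$$ and if $\chi_i(S)=0$ then by convention $\lambda_i^+=\chi_i(R)$ and $\lambda_i^-=\chi_i(L)$.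
   Formalization: The formal statement takes a = gh^{-1} instead of a = g^{-1}h; as printed, (3) fails for G = Z/3, R = L = ∅, S = {s}, u = (1,0), v = (s,1), t = π/2. Cases (1) and (2) are unaffected. *)

(* Defs.v *)
From HB Require Import structures.
From mathcomp Require Import all_boot all_order all_algebra all_fingroup.
From mathcomp Require Import complex.
From mathcomp Require Import all_classical all_reals all_analysis.

Set Implicit Arguments.
Unset Strict Implicit.
Unset Printing Implicit Defensive.

Import Order.TTheory GRing.Theory Num.Theory.
Import numFieldNormedType.Exports.

Local Open Scope ring_scope.
Local Open Scope complex_scope.

(* The limit of the partial sums is taken entry by entry, in the topology
   given by the norm of K. *)
Definition expmx (K : numFieldType) (m : nat) (A : 'M[K]_m) : 'M[K]_m :=
  \matrix_(i, j) limn (series (fun k => (A ^+ k) i j / k`!%:R)).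

Definition expC (K : realType) (z : K[i]) : K[i] :=
  (expR (complex.Re z))%:C * (cos (complex.Im z) +i* sin (complex.Im z)).

Section Graphs.
Variables (K : realType) (T : finType).

(* Rows and columns follow the enumeration of T: the (u, v) entry is at
   (enum_rank u, enum_rank v). *)
Definition adjmx (e : rel T) : 'M[K[i]]_#|T| :=
  \matrix_(i, j) (e (enum_val i) (enum_val j))%:R.

Definition transition (e : rel T) (t : K) : 'M[K[i]]_#|T| :=
  expmx ((- 'i * t%:C) *: adjmx e).

Definition PST (e : rel T) (u v : T) (t : K) : Prop :=
  `|transition e t (enum_rank u) (enum_rank v)| = 1.

End Graphs.

Section SemiCayley.
Variable gT : finGroupType.

Definition sc_arc (R L S : {set gT}) : rel (gT * 'I_2) := fun u v =>
  let q := (v.1 * u.1^-1)%g in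
  [|| [&& u.2 == 0, v.2 == 0 & q \in R],
      [&& u.2 == 1, v.2 == 1 & q \in L] |
      [&& u.2 == 0, v.2 == 1 & q \in S]].

(* Edges are unordered pairs, hence the symmetric closure. *)
Definition SC (R L S : {set gT}) : rel (gT * 'I_2) := fun u v =>
  sc_arc R L S u v || sc_arc R L S v u.

Lemma SC_sym (R L S : {set gT}) : symmetric (SC R L S).
Proof. by move=> u v; rewrite /SC orbC. Qed.

Lemma SC_irr (R L S : {set gT}) : 1%g \notin R :|: L -> irreflexive (SC R L S).
Proof.
rewrite inE negb_or => /andP[R1 L1] [x i].
rewrite /SC orbb /sc_arc /= mulgV (negbTE R1) (negbTE L1) !andbF /=.
by case: eqP => //= ->.
Qed.

End SemiCayley.

Section Characters.
Variables (K : realType) (gT : finGroupType).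

(* For abelian gT these are exactly the complex irreducible characters. *)
Definition lin_character (f : gT -> K[i]) : Prop :=
  (forall x, f x != 0) /\ (forall x y, f (x * y)%g = f x * f y).

(* chi lists every character exactly once. *)
Definition Irr_enum (n : nat) (chi : 'I_n -> gT -> K[i]) : Prop :=
  [/\ forall i, lin_character (chi i),
      injective chi &
      forall f, lin_character f -> exists i, f = chi i].

Definition chisum (f : gT -> K[i]) (Y : {set gT}) : K[i] := \sum_(y in Y) f y.

Variables (R L S : {set gT}).

(* The radicand is real and nonnegative when R and L are closed under inverse,
   and sqrtC is then the usual nonnegative square root. *)
Definition lambda_disc (f : gT -> K[i]) : K[i] :=
  sqrtC ((chisum f R - chisum f L) ^+ 2 + 4 * `|chisum f S| ^+ 2).

Definition lambdap (f : gT -> K[i]) : K[i] :=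
  if chisum f S == 0 then chisum f R
  else 2^-1 * (chisum f R + chisum f L + lambda_disc f).

Definition lambdam (f : gT -> K[i]) : K[i] :=
  if chisum f S == 0 then chisum f L
  else 2^-1 * (chisum f R + chisum f L - lambda_disc f).

End Characters.

(* Main.v *)
(* On the functions (b_0 chi, b_1 chi), with chi a character, the adjacency
   matrix acts as the Hermitian 2x2 block
   M_chi = [[chi(R), chi(S)], [chi(S)^*, chi(L)]], whose eigenvalues are
   lambda^+ and lambda^-.  Hence
     H(t)_{(x,p),(y,q)} = n^-1 sum_chi chi(x y^-1) exp(-i t M_chi)_{p,q},
   a mean of n numbers of the closed unit disk.  It has modulus 1 iff all of
   them equal the one for the trivial character and have modulus 1.  A diagonal
   entry of the unitary matrix exp(-i t M_chi) has modulus 1 iff chi(S) = 0 or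
   both eigenvalues of the exponential agree; an off-diagonal one does iff
   chi(S) != 0, chi(R) = chi(L) and the two eigenvalues are opposite.  Finally,
   chi(R) = chi(L) for every chi forces R = L. *)
Require Import Defs.
From HB Require Import structures.
From mathcomp Require Import all_boot all_order all_algebra all_fingroup.
From mathcomp Require Import complex ring.
From mathcomp Require Import all_classical all_reals all_analysis.

Set Implicit Arguments.
Unset Strict Implicit.
Unset Printing Implicit Defensive.

Import Order.TTheory GRing.Theory Num.Theory.
Import numFieldNormedType.Exports.

Local Open Scope ring_scope.
Local Open Scope complex_scope.

(** * Exponential series of scalars and of matrices *)

Section ExponentialSeries.
Local Open Scope classical_set_scope.

(* The topology is declared on numFieldType, so K[i] has to be seen as one. *)
Local Notation C K := (Num.NumField.sort K[i]).

Lemma cvg_real_complex (K : realType) (u : nat -> K) (l : K) :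
  u @ \oo --> l -> (fun n => (u n)%:C : C K) @ \oo --> (l%:C : C K).
Proof.
move=> /cvgrPdist_lt ul; apply/cvgrPdist_lt => e e0.
(* A positive element of [K[i]] has zero imaginary part, so its real part serves as the tolerance in
   [K]. *)
move: (e0); rewrite ltcE /= => /andP[/eqP ei er].
near=> n.
rewrite -raddfB normc_def /= expr0n addr0 sqrtr_sqr ltcE /= -ei eqxx /=.
near: n; exact: ul.
Unshelve. all: by end_near. Qed.

Lemma expi_coeff (K : realType) (x : K) k :
  ('i * x%:C) ^+ k / k`!%:R =
    (cos_coeff x k)%:C + 'i * (sin_coeff x k)%:C :> K[i].
Proof.
rewrite exprMn -[in 'i ^+ k](odd_double_half k) exprD -muln2 mulnC exprM sqrCi.
rewrite /cos_coeff /sin_coeff.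
rewrite !rmorphM !rmorphXn ?fmorphV ?rmorph_nat !rmorphN1.
case ko: (odd k); rewrite /= ?expr1 ?expr0 !(mul0r, mul1r, add0r, mulr0, addr0).
  (* The power of i produces [k./2], [sin_coeff] uses [k.-1./2]; they agree for odd [k]. *)
  have -> : k./2 = k.-1./2.
    by case: k ko => //= k; rewrite uphalf_half => /negbTE ->.
  by rewrite !mulrA.
by rewrite ?exprnP ?mulrA.
Qed.

Lemma cvg_expi (K : realType) (x : K) :
  series (fun k => ('i * x%:C) ^+ k / k`!%:R : C K) @ \oo -->
    (expC ('i * x%:C) : C K).
Proof.
have -> : series (fun k => ('i * x%:C) ^+ k / k`!%:R : C K) =
  (fun n => (series (cos_coeff x) n)%:C + 'i * (series (sin_coeff x) n)%:C : C K).
  apply/funext => n; rewrite /series /= !rmorph_sum mulr_sumr -big_split /=.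
  by apply: eq_bigr => k _; rewrite expi_coeff.
have -> : expC ('i * x%:C) = (cos x)%:C + 'i * (sin x)%:C :> K[i].
  rewrite /expC -complexiE /= !(mul0r, mul1r, mulr0, subrr, addr0) expR0.
  congr (_ +i* _);
    by rewrite !(mul0r, mul1r, mulr0, subr0, subrr, addr0, add0r, oppr0).
apply: cvgD; last apply: cvgMr.
- by apply: cvg_real_complex; rewrite cos.unlock; exact: is_cvg_series_cos_coeff.
- by apply: cvg_real_complex; rewrite sin.unlock; exact: is_cvg_series_sin_coeff.
Qed.

(** The limit passes through the finite sum over [l]. Only the entries of the powers are needed, so
    no diagonalizing matrix has to be built. *)
Lemma expmx_spectral (F : numFieldType) m (A : 'M[F]_m) (I : finType)
    (c mu e : I -> F) i j :
  (forall l, series (fun k => mu l ^+ k / k`!%:R) @ \oo --> e l) ->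
  (forall k, (A ^+ k) i j = \sum_l c l * mu l ^+ k) ->
  expmx A i j = \sum_l c l * e l.
Proof.
move=> muE AE; rewrite mxE.
apply: cvg_lim; first exact: norm_hausdorff.
have -> : series (fun k => (A ^+ k) i j / k`!%:R) =
  fun n => \sum_l c l * series (fun k => mu l ^+ k / k`!%:R) n.
  apply/funext => n; rewrite /series /=.
  under [RHS]eq_bigr do rewrite mulr_sumr.
  rewrite exchange_big /=; apply: eq_bigr => k _.
  by rewrite AE mulr_suml; apply: eq_bigr => l _; rewrite mulrA.
apply: (@cvg_big _ _ +%R) => [|l _]; first exact: add_continuous.
by apply: cvgMr; exact: muE.
Qed.

Lemma expmx_i_spectral (K : realType) m (A : 'M[K[i]]_m) (I : finType)
    (c : I -> K[i]) (x : I -> K) i j :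
  (forall k, (A ^+ k) i j = \sum_l c l * ('i * (x l)%:C) ^+ k) ->
  expmx A i j = \sum_l c l * expC ('i * (x l)%:C).
Proof. by apply: expmx_spectral => l; exact: cvg_expi. Qed.

End ExponentialSeries.

(** * Elementary properties of the complex exponential *)

Lemma expCD (K : realType) (z w : K[i]) : expC (z + w) = expC z * expC w.
Proof.
case: z w => [a b] [c d]; rewrite /expC /= expRD cosD sinD.
simpc; congr (_ +i* _); ring.
Qed.

Lemma expC0 (K : realType) : expC (0 : K[i]) = 1.
Proof. by rewrite /expC /= expR0 cos0 sin0; simpc. Qed.

Lemma norm_expC (K : realType) (z : K[i]) : complex.Re z = 0 -> `|expC z| = 1.
Proof.
case: z => a b /= ->; rewrite /expC /= expR0 normc_def /=; simpc.
by rewrite cos2Dsin2 sqrtr1.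
Qed.

(** * Linear characters and their orthogonality relations *)

Section LinearCharacters.
Variables (K : realType) (gT : finGroupType).
Implicit Types (f : gT -> K[i]) (x y : gT).

Lemma lin_character1 f : lin_character f -> f 1%g = 1.
Proof.
by case=> fn0 fM; apply: (mulfI (fn0 1%g)); rewrite -fM mulg1 mulr1.
Qed.

Lemma lin_characterV f x : lin_character f -> f x^-1%g = (f x)^-1.
Proof.
move=> fl; have [fn0 fM] := fl; apply: (mulfI (fn0 x)).
by rewrite -fM mulgV lin_character1 // mulfV.
Qed.

Lemma lin_characterX f x m : lin_character f -> f (x ^+ m)%g = f x ^+ m.
Proof.
move=> fl; have [_ fM] := fl.
by elim: m => [|m IH]; rewrite ?expg0 ?lin_character1 // expgS exprS fM IH.
Qed.

(** The value is a root of unity, because [x] has finite order. *)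
Lemma norm_lin_character f x : lin_character f -> `|f x| = 1.
Proof.
move=> fl; apply/eqP; rewrite -(@pexpr_eq1 _ _ #[x]%g) ?normr_ge0 //.
by rewrite -normrX -lin_characterX // expg_order lin_character1 // normr1.
Qed.

Lemma conj_lin_character f x : lin_character f -> ((f x)^* )%R = f x^-1%g.
Proof.
move=> fl; rewrite lin_characterV // invC_norm norm_lin_character //.
by rewrite expr1n invr1 mul1r.
Qed.

(** Translation by [y] permutes the group and multiplies the sum by [f y]. *)
Lemma sum_lin_character f y : lin_character f -> f y != 1 -> \sum_x f x = 0.
Proof.
move=> [fn0 fM] fy1; apply/eqP.
have : f y * \sum_x f x == \sum_x f x.
  rewrite mulr_sumr [eqbRHS](reindex_inj (mulgI y)); apply/eqP/eq_bigr => x _.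
  by rewrite fM.
by rewrite -subr_eq0 -[X in _ - X]mul1r -mulrBl mulf_eq0 subr_eq0 (negbTE fy1).
Qed.

Lemma lin_character_div f1 f2 :
  lin_character f1 -> lin_character f2 ->
  lin_character (fun x => f1 x * f2 x^-1%g).
Proof.
move=> f1l f2l; have [f1n0 f1M] := f1l; have [f2n0 f2M] := f2l.
split=> [x|x y]; first by rewrite mulf_neq0.
by rewrite invMg f1M f2M; ring.
Qed.

Lemma conj_chisum f (Y : {set gT}) :
  lin_character f -> ((chisum f Y)^* )%R = \sum_(y in Y) f y^-1%g.
Proof.
move=> fl; rewrite rmorph_sum; apply: eq_bigr => y _.
exact: conj_lin_character.
Qed.

Lemma chisum_real f (Y : {set gT}) :
  lin_character f -> Y = (Y^-1)%g -> chisum f Y \is Num.real.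
Proof.
move=> fl YV; apply/CrealP; rewrite conj_chisum //.
rewrite /chisum [RHS](reindex_inj invg_inj); apply: eq_bigl => y.
by rewrite [in LHS]YV inE.
Qed.

Variables (n : nat) (Gn : #|gT| = n) (chi : 'I_n -> gT -> K[i]).
Hypothesis chiIrr : Irr_enum chi.

Lemma Irr_lin i : lin_character (chi i).
Proof. by case: chiIrr. Qed.

Lemma order_neq0 : n%:R != 0 :> K[i].
Proof. by rewrite pnatr_eq0 -Gn -lt0n; apply/card_gt0P; exists 1%g. Qed.

Lemma Irr_row_orthogonality i j :
  \sum_x chi i x * chi j x^-1%g = n%:R * (i == j)%:R.
Proof.
have [<-|ij] := eqVneq i j.
  rewrite (eq_bigr (fun=> 1)) => [|x _]; last first.
    by rewrite lin_characterV ?divff //; [case: (Irr_lin i) | exact: Irr_lin].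
  by rewrite sumr_const mulr1 cardT -cardE Gn.
rewrite mulr0.
have [y fy] : exists y, chi i y * chi j y^-1%g != 1.
  apply/not_existsP => H; case/eqP: ij; case: chiIrr => _ inj _; apply: inj.
  apply/funext => y; have /negP := H y.
  rewrite negbK lin_characterV //; last exact: Irr_lin.
  by rewrite -subr_eq0 => /eqP /subr0_eq /divr1_eq.
apply: sum_lin_character fy.
by apply: lin_character_div; exact: Irr_lin.
Qed.

(** There are as many characters as group elements, so the character table [P] is square. Row
    orthogonality gives it the right inverse [Q], which is then a left inverse, and the entries of
    [Q *m P] are the column relations. *)
Lemma Irr_column_orthogonality x y :
  \sum_i chi i (x * y^-1)%g = n%:R * (x == y)%:R.
Proof.
have [e eK] : exists e : 'I_n -> gT, bijective e.
  case: n / Gn; exists enum_val; exact: enum_val_bij.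
have [e' ee' e'e] := eK.
pose P := \matrix_(i < n, j < n) chi i (e j).
pose Q := \matrix_(j < n, i < n) (n%:R^-1 * chi i (e j)^-1%g).
have PQ : P *m Q = 1%:M.
  apply/matrixP => i j; rewrite !mxE.
  under eq_bigr do rewrite !mxE mulrCA.
  rewrite -mulr_sumr.
  rewrite -[X in _ * X](reindex e (P := predT)
    (F := fun x => chi i x * chi j x^-1%g)) /=.
    by rewrite Irr_row_orthogonality mulKf ?order_neq0.
  by exists e' => ? _.
have /matrixP /(_ (e' y) (e' x)) := mulmx1C PQ.
rewrite !mxE; under eq_bigr do
  rewrite !mxE !e'e -mulrA mulrC [X in X * _]mulrC -(proj2 (Irr_lin _)).
rewrite -mulr_suml => /(canRL (mulfVK order_neq0)) ->.
by rewrite mulrC (can_eq e'e) eq_sym.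
Qed.

(** Fourier inversion: by column orthogonality the character sums of a set recover its indicator
    function. *)
Lemma chisum_inj (Y Z : {set gT}) :
  (forall i, chisum (chi i) Y = chisum (chi i) Z) -> Y = Z.
Proof.
move=> YZ; apply/setP => x.
have ind (W : {set gT}) :
    \sum_i chi i x^-1%g * chisum (chi i) W = n%:R * (x \in W)%:R.
  under eq_bigr do rewrite /chisum mulr_sumr.
  rewrite exchange_big /=.
  under eq_bigr => y _ do under eq_bigr do rewrite mulrC -(proj2 (Irr_lin _)).
  under eq_bigr do rewrite Irr_column_orthogonality.
  rewrite -mulr_sumr; congr (_ * _); rewrite -natr_sum -big_mkcondr.
  rewrite sum1_card; congr _%:R.
  have [xW|xW] := boolP (x \in W).
    transitivity #|pred1 x|; last exact: card1.
    apply: eq_card => y; rewrite inE unfold_in.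
    by case: eqP => [->|]; rewrite ?xW ?andbF.
  apply: eq_card0 => y; rewrite unfold_in.
  by case: eqP => [->|]; rewrite ?(negbTE xW) ?andbF.
have : n%:R * (x \in Y)%:R = n%:R * (x \in Z)%:R :> K[i].
  by rewrite -!ind; apply: eq_bigr => i _; rewrite YZ.
by move/(mulfI order_neq0)/eqP; rewrite eqr_nat => /eqP; do 2!case: (x \in _).
Qed.

End LinearCharacters.

(** * Functional calculus of a Hermitian 2x2 matrix *)

Section HermitianBlock.
Variables (C : numClosedFieldType) (a b c : C).
Hypotheses (aR : a \is Num.real) (bR : b \is Num.real).
Implicit Types (p q : 'I_2) (e f : C).

(** At the sums of a character over [R], [L], [S], this and the next two definitions are convertible
    to [lambda_disc], [lambdap], [lambdam]. *)
Definition herm2_disc : C := sqrtC ((a - b) ^+ 2 + 4 * `|c| ^+ 2).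
Definition herm2_eigp : C :=
  if c == 0 then a else 2^-1 * (a + b + herm2_disc).
Definition herm2_eigm : C :=
  if c == 0 then b else 2^-1 * (a + b - herm2_disc).

Definition herm2 p q : C :=
  if p == 0 then if q == 0 then a else c else if q == 0 then (c^* )%R else b.

(* Entries of the spectral projections of [[a, c], [c^*, b]].  When c = 0 the
   first coordinate is attached to herm2_eigp whatever the order of a and b. *)
Definition herm2_projp p q : C :=
  if c == 0 then ((p == q) && (p == 0))%:R
  else (herm2 p q - herm2_eigm * (p == q)%:R) / herm2_disc.
Definition herm2_projm p q : C :=
  if c == 0 then ((p == q) && (p == 1))%:R
  else (herm2_eigp * (p == q)%:R - herm2 p q) / herm2_disc.

(* The entries of F(M), where M = [[a, c], [c^*, b]] and e, f are the values of
   F at the eigenvalues herm2_eigp, herm2_eigm. *)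
Definition herm2_fun e f p q : C := herm2_projp p q * e + herm2_projm p q * f.

Lemma ord2_case p : p = 0 \/ p = 1.
Proof. by case: p => [[|[|]] // ?]; [left|right]; apply: val_inj. Qed.

Let disc_sq : herm2_disc ^+ 2 = (a - b) ^+ 2 + 4 * (c * c^*).
Proof. by rewrite sqrtCK normCK. Qed.

Let abR : a - b \is Num.real. Proof. exact: realB. Qed.

Let rad_ge0 : 0 <= (a - b) ^+ 2 + 4 * `|c| ^+ 2.
Proof.
by apply: addr_ge0; [exact: real_exprn_even_ge0 | rewrite mulr_ge0 ?exprn_ge0].
Qed.

Lemma herm2_disc_ge0 : 0 <= herm2_disc.
Proof. by rewrite sqrtC_ge0. Qed.

(** The squares differ by [(a - b) ^+ 2]. This inequality bounds the off-diagonal entries of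
    [herm2_fun], and its equality case forces [a = b]. *)
Lemma herm2_disc_ge : 2 * `|c| <= herm2_disc.
Proof.
rewrite -(@ler_pXn2r _ 2) ?nnegrE ?herm2_disc_ge0 ?mulr_ge0 //.
rewrite sqrtCK exprMn -natrX lerDr; exact: real_exprn_even_ge0.
Qed.

Lemma herm2_disc_eq : (2 * `|c| == herm2_disc) = (a == b).
Proof.
rewrite -(@eqrXn2 _ 2) ?herm2_disc_ge0 ?mulr_ge0 //.
rewrite sqrtCK exprMn -natrX -subr_eq0 opprD addrCA subrr addr0 oppr_eq0.
by rewrite expf_eq0 subr_eq0.
Qed.

Lemma herm2_disc_gt0 : c != 0 -> 0 < herm2_disc.
Proof.
move=> c0; apply: lt_le_trans herm2_disc_ge; by rewrite mulr_gt0 ?normr_gt0.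
Qed.

Lemma herm2_disc_bounds : c != 0 -> - herm2_disc < a - b < herm2_disc.
Proof.
move=> c0; rewrite -real_ltr_norml //.
rewrite -(@ltr_pXn2r _ 2) ?nnegrE ?herm2_disc_ge0 // sqrtCK.
by rewrite real_normK // ltrDl mulr_gt0 ?exprn_gt0 ?normr_gt0.
Qed.

Lemma herm2_eigp_real : herm2_eigp \is Num.real.
Proof.
rewrite /herm2_eigp; case: ifP => // _.
by rewrite realM ?realV ?realn // !realD // ger0_real // herm2_disc_ge0.
Qed.

Lemma herm2_eigm_real : herm2_eigm \is Num.real.
Proof.
rewrite /herm2_eigm; case: ifP => // _.
by rewrite realM ?realV ?realn // realB ?realD // ger0_real // herm2_disc_ge0.
Qed.

Lemma herm2_proj_sum p q : herm2_projp p q + herm2_projm p q = (p == q)%:R.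
Proof.
rewrite /herm2_projp /herm2_projm; case: ifPn => [_|c0].
  by have [-> | ->] := ord2_case p; have [-> | ->] := ord2_case q;
    rewrite ?addr0 ?add0r.
have D0 : herm2_disc != 0 by rewrite gt_eqF ?herm2_disc_gt0.
rewrite /herm2_eigp /herm2_eigm (negbTE c0).
apply: (mulIf D0); rewrite -mulrDl mulfVK //; by field.
Qed.

(** For nonzero [c] this is Cayley-Hamilton: the projection is a multiple of M minus the other
    eigenvalue. *)
Lemma herm2_mul_projp p q :
  \sum_o herm2 p o * herm2_projp o q = herm2_eigp * herm2_projp p q.
Proof.
rewrite !big_ord_recl big_ord0 addr0 /herm2_projp /herm2_eigp /herm2_eigm.
have [c0|c0] := eqVneq c 0.
  by have [-> | ->] := ord2_case p; have [-> | ->] := ord2_case q;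
    rewrite /herm2 c0 /= ?conjC0 ?mulr0 ?mul0r ?addr0 ?add0r.
rewrite !mulrA -mulrDl; congr (_ / _).
(* Trading [c * c^*] for the discriminant makes each entry a rational identity. *)
have c2 : c * c^* = 4^-1 * (herm2_disc ^+ 2 - (a - b) ^+ 2).
  by rewrite disc_sq addrC addKr mulKf // pnatr_eq0.
have [-> | ->] := ord2_case p; have [-> | ->] := ord2_case q;
    rewrite /herm2 /= ?mulr0 ?mulr1 ?subr0 ?[c^* * c]mulrC ?c2; by field.
Qed.

Lemma herm2_mul_projm p q :
  \sum_o herm2 p o * herm2_projm o q = herm2_eigm * herm2_projm p q.
Proof.
rewrite !big_ord_recl big_ord0 addr0 /herm2_projm /herm2_eigp /herm2_eigm.
have [c0|c0] := eqVneq c 0.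
  by have [-> | ->] := ord2_case p; have [-> | ->] := ord2_case q;
    rewrite /herm2 c0 /= ?conjC0 ?mulr0 ?mul0r ?addr0 ?add0r.
rewrite !mulrA -mulrDl; congr (_ / _).
have c2 : c * c^* = 4^-1 * (herm2_disc ^+ 2 - (a - b) ^+ 2).
  by rewrite disc_sq addrC addKr mulKf // pnatr_eq0.
have [-> | ->] := ord2_case p; have [-> | ->] := ord2_case q;
    rewrite /herm2 /= ?mulr0 ?mulr1 ?subr0 ?sub0r ?mulrN
      ?[c^* * c]mulrC ?c2; by field.
Qed.

(** The weight is [(herm2_disc + (a - b)) / (2 * herm2_disc)] for [p = 0], with the sign of [a - b]
    reversed for [p = 1]. *)
Lemma herm2_projp_diag_gt0 p : c != 0 -> 0 < herm2_projp p p.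
Proof.
move=> c0; have D0 := herm2_disc_gt0 c0.
rewrite /herm2_projp /herm2_eigm (negbTE c0) eqxx mulr1 divr_gt0 //.
have /andP[l1 l2] := herm2_disc_bounds c0.
have [-> | ->] := ord2_case p; rewrite /herm2 /=.
  suff -> : a - 2^-1 * (a + b - herm2_disc) = 2^-1 * (a - b + herm2_disc).
    by rewrite mulr_gt0 ?invr_gt0 // -ltrBlDr sub0r.
  by field.
suff -> : b - 2^-1 * (a + b - herm2_disc) = 2^-1 * (herm2_disc - (a - b)).
  by rewrite mulr_gt0 ?invr_gt0 // subr_gt0.
by field.
Qed.

Lemma herm2_projm_diag_gt0 p : c != 0 -> 0 < herm2_projm p p.
Proof.
move=> c0; have D0 := herm2_disc_gt0 c0.
rewrite /herm2_projm /herm2_eigp (negbTE c0) eqxx mulr1 divr_gt0 //.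
have /andP[l1 l2] := herm2_disc_bounds c0.
have [-> | ->] := ord2_case p; rewrite /herm2 /=.
  suff -> : 2^-1 * (a + b + herm2_disc) - a = 2^-1 * (herm2_disc - (a - b)).
    by rewrite mulr_gt0 ?invr_gt0 // subr_gt0.
  by field.
suff -> : 2^-1 * (a + b + herm2_disc) - b = 2^-1 * (a - b + herm2_disc).
  by rewrite mulr_gt0 ?invr_gt0 // -ltrBlDr sub0r.
by field.
Qed.

Lemma herm2_fun_diag e p : c != 0 -> herm2_fun e e p p = e.
Proof. by rewrite /herm2_fun -mulrDl herm2_proj_sum eqxx mul1r. Qed.

Lemma herm2_fun_c0 e f p q : c = 0 ->
  herm2_fun e f p q = if p == q then if p == 0 then e else f else 0.
Proof.
move=> c0; rewrite /herm2_fun /herm2_projp /herm2_projm c0 eqxx.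
by have [-> | ->] := ord2_case p; have [-> | ->] := ord2_case q;
  rewrite /= ?mul1r ?mul0r ?addr0 ?add0r.
Qed.

(* A diagonal entry is a convex combination of e and f with positive weights. *)
Lemma norm_herm2_fun_diag e f p : c != 0 -> `|e| = 1 -> `|f| = 1 ->
  `|herm2_fun e f p p| = 1 <-> e = f.
Proof.
move=> c0 e1 f1; split=> [|<-]; last by rewrite herm2_fun_diag.
have pp := herm2_projp_diag_gt0 p c0; have pm := herm2_projm_diag_gt0 p c0.
(* Equality in the triangle inequality: both summands are nonnegative multiples of one unit [z]. *)
move=> H; have /normCDeq [z _ [ze zf]] :
    `|herm2_projp p p * e + herm2_projm p p * f| =
    `|herm2_projp p p * e| + `|herm2_projm p p * f|.
  rewrite -/(herm2_fun e f p p) H !normrM e1 f1 !mulr1 !gtr0_norm //.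
  by rewrite herm2_proj_sum eqxx.
move: ze zf; rewrite !normrM e1 f1 !mulr1 !gtr0_norm //.
by move=> /(mulfI (lt0r_neq0 pp)) -> /(mulfI (lt0r_neq0 pm)) ->.
Qed.

(** The projections add up to the identity, so off the diagonal they are opposite. *)
Lemma herm2_fun_offdiag e f p q : c != 0 -> p != q ->
  herm2_fun e f p q = herm2 p q * (e - f) / herm2_disc.
Proof.
move=> c0 /negbTE pq.
rewrite /herm2_fun /herm2_projp /herm2_projm (negbTE c0) pq !mulr0 subr0 sub0r.
by ring.
Qed.

Lemma norm_herm2_offdiag p q : p != q -> `|herm2 p q| = `|c|.
Proof.
by have [-> | ->] := ord2_case p; have [-> | ->] := ord2_case q;
  rewrite /herm2 //= norm_conjC.
Qed.

Lemma norm_herm2_fun_offdiag e f p q :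
  c != 0 -> p != q -> `|e| = 1 -> `|f| = 1 ->
  `|herm2_fun e f p q| = 1 <-> a = b /\ e = - f.
Proof.
(* |c| |e - f| / disc <= 2 |c| / disc <= 1, with equality in the last step iff
   a = b. *)
move=> c0 pq e1 f1; rewrite herm2_fun_offdiag // normrM normrM normfV.
rewrite norm_herm2_offdiag // (ger0_norm herm2_disc_ge0).
have D0 := herm2_disc_gt0 c0; have D1 := lt0r_neq0 D0.
split=> [/(canRL (mulfVK D1)) | [ab ->]]; last first.
  move/eqP: ab; rewrite -herm2_disc_eq => /eqP DE.
  by rewrite -opprD normrN -mulr2n normrMn f1 [`|c| * _]mulrC DE divff.
rewrite mul1r => DE.
have le2 : `|e - f| <= 2 by rewrite (le_trans (ler_normB _ _)) // e1 f1.
have cD : 2 * `|c| = herm2_disc.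
  apply/eqP; rewrite eq_le herm2_disc_ge -DE mulrC.
  by rewrite ler_wpM2r.
split; first by apply/eqP; rewrite -herm2_disc_eq cD.
have ef : `|e - f| = 2.
  have nc0 : `|c| != 0 by rewrite normr_eq0.
  by move: DE; rewrite -cD mulrC => /(mulIf nc0).
have /normCDeq [z _ []] : `|e - f| = `|e| + `|- f| by rewrite normrN e1 f1 ef.
by rewrite normrN e1 f1 => -> ->.
Qed.

(** A diagonal entry is a convex combination of units; off the diagonal [|e - f| <= 2] meets
    [herm2_disc_ge]. *)
Lemma norm_herm2_fun_le1 e f p q : `|e| = 1 -> `|f| = 1 ->
  `|herm2_fun e f p q| <= 1.
Proof.
move=> e1 f1; have [c0|c0] := eqVneq c 0.
  rewrite herm2_fun_c0 //; case: ifP => _; last by rewrite normr0.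
  by case: ifP; rewrite ?e1 ?f1.
have [<-|pq] := eqVneq p q.
  have pp := herm2_projp_diag_gt0 p c0; have pm := herm2_projm_diag_gt0 p c0.
  rewrite (le_trans (ler_normD _ _)) // !normrM e1 f1 !mulr1 !gtr0_norm //.
  by rewrite herm2_proj_sum eqxx.
rewrite herm2_fun_offdiag // normrM normrM normfV norm_herm2_offdiag //.
rewrite (ger0_norm herm2_disc_ge0) ler_pdivrMr ?herm2_disc_gt0 // mul1r.
apply: le_trans herm2_disc_ge; rewrite mulrC ler_wpM2r //.
by rewrite (le_trans (ler_normB _ _)) // e1 f1.
Qed.

End HermitianBlock.

(** * Entries of modulus 1, with zero and nonzero [c] treated together *)

Section HermitianEvolution.
Variables (C : numClosedFieldType) (a b c : C).
Hypotheses (aR : a \is Num.real) (bR : b \is Num.real).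
Variables (e f : C).
Hypotheses (e1 : `|e| = 1) (f1 : `|f| = 1).
Implicit Types (p q : 'I_2).

(** For [c = 0] the matrix is diagonal with unit entries and imposes nothing; this is the source of
    the restriction to [j \notin X] in the theorem. *)
Lemma norm_herm2_fun_diagP p :
  `|herm2_fun a b c e f p p| = 1 <-> (c != 0 -> e = f).
Proof.
have [c0|c0] := eqVneq c 0.
  by rewrite herm2_fun_c0 // eqxx; split=> // _; case: ifP.
by rewrite norm_herm2_fun_diag //; split=> // /(_ isT).
Qed.

Lemma herm2_fun_diagE p : (c != 0 -> e = f) ->
  herm2_fun a b c e f p p = if p == 0 then e else f.
Proof.
have [c0 _|c0 /(_ isT) <-] := eqVneq c 0; first by rewrite herm2_fun_c0 // eqxx.
by rewrite herm2_fun_diag // if_same.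
Qed.

Lemma norm_herm2_fun_offdiagP p q : p != q ->
  `|herm2_fun a b c e f p q| = 1 <-> [/\ c != 0, a = b & e = - f].
Proof.
move=> pq; have [c0|c0] := eqVneq c 0.
  rewrite herm2_fun_c0 // (negbTE pq) normr0.
  by split=> [/esym/eqP | [//]]; rewrite oner_eq0.
by rewrite norm_herm2_fun_offdiag //; split=> [[] | []].
Qed.

(** Here the discriminant is [2 * |c|] and [e - f] is [2 * e]; the phase left over becomes the
    factor in cases (3) and (4). *)
Lemma herm2_fun_offdiagE p q : p != q -> c != 0 -> a = b -> e = - f ->
  herm2_fun a b c e f p q = herm2 a b c p q / `|c| * e.
Proof.
move=> pq c0 /eqP; rewrite -(herm2_disc_eq c aR bR) => /eqP DE ef.
rewrite herm2_fun_offdiag // -DE -[f]opprK -ef opprK.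
have nc0 : `|c| != 0 by rewrite normr_eq0.
by field.
Qed.
End HermitianEvolution.

(** The modulus of the sum is at most the sum of the moduli, itself at most [n]. Both bounds are
    attained, so all terms are units and all are aligned. *)
Lemma norm_mean_eq1 (C : numClosedFieldType) n (z : 'I_n -> C) :
  (forall i, `|z i| <= 1) -> `|n%:R^-1 * \sum_i z i| = 1 ->
  exists2 w, `|w| = 1 & forall i, z i = w.
Proof.
move=> z1 zm.
(* For [n = 0] the mean would be 0, since the inverse of 0 is 0. *)
have n0 : n%:R != 0 :> C.
  by apply: contra_eq_neq zm => ->; rewrite invr0 mul0r normr0 eq_sym oner_eq0.
have zn : `|\sum_i z i| = n%:R.
  by apply: (mulfI (invr_neq0 n0)); rewrite mulVf // -{2}zm normrM normfV normr_nat.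
have sum1 : \sum_i `|z i| = \sum_(i < n) (1 : C).
  apply/le_anti/andP; split; first exact: ler_sum.
  by rewrite sumr_const card_ord -zn ler_norm_sum.
have zi1 i : `|z i| = 1.
  by apply: (normC_sum_upper _ sum1) => // j _; rewrite normr_id.
have [| w /eqP w1 zw] := @normC_sum_eq1 C _ predT z _ (fun i _ => zi1 i).
  by rewrite sum1 zn sumr_const card_ord.
by exists w => // i; exact: zw.
Qed.

Lemma exprZmx (F : comNzRingType) m (a : F) (A : 'M[F]_m) k :
  (a *: A) ^+ k = a ^+ k *: A ^+ k.
Proof.
elim: k => [|k IH]; first by rewrite !expr0 scale1r.
by rewrite !exprS IH -!mulmxE -scalemxAl -scalemxAr scalerA.
Qed.

(** * Spectral form of the transition matrix of a semi-Cayley graph *)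

Section Transition.
Variables (K : realType) (gT : finGroupType) (R L S : {set gT}).
Hypotheses (RV : R = (R^-1)%g) (LV : L = (L^-1)%g).

Notation blk f := (herm2 (chisum f R) (chisum f L) (chisum f S)).

Let inRV x : (x^-1%g \in R) = (x \in R). Proof. by rewrite {1}RV inE invgK. Qed.
Let inLV x : (x^-1%g \in L) = (x \in L). Proof. by rewrite {1}LV inE invgK. Qed.

(** The substitution [z = y * x] factors out [f x]. From layer 1 to layer 0 the connection set is
    the inverse of [S], whence the conjugate in the block. *)
Lemma SC_character (f : gT -> K[i]) x (p q : 'I_2) : lin_character f ->
  \sum_z (SC R L S (x, p) (z, q))%:R * f z = f x * blk f p q.
Proof.
move=> fl; have [_ fM] := fl.
have E (Y : {set gT}) : \sum_z (z * x^-1 \in Y)%g%:R * f z = f x * chisum f Y.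
  rewrite (reindex_inj (mulIg x)) /chisum mulr_sumr [RHS]big_mkcond /=.
  apply: eq_bigr => y _; rewrite mulgK fM.
  by case: (y \in Y); rewrite ?mul0r ?mul1r // mulrC.
have [-> | ->] := ord2_case p; have [-> | ->] := ord2_case q.
- rewrite /herm2 /= -E; apply: eq_bigr => z _; rewrite /SC /sc_arc /= !orbF.
  by rewrite -[(x * _)%g]invgK invMg invgK inRV orbb.
- by rewrite /herm2 /= -E; apply: eq_bigr => z _; rewrite /SC /sc_arc /= !orbF.
- rewrite /herm2 /= conj_chisum // (reindex_inj (inj_comp (mulIg x) invg_inj)).
  rewrite mulr_sumr [RHS]big_mkcond /=.
  apply: eq_bigr => y _; rewrite /SC /sc_arc /= invMg invgK mulKVg fM.
  by case: (y \in S); rewrite ?mul0r ?mul1r // mulrC.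
- rewrite /herm2 /= -E; apply: eq_bigr => z _; rewrite /SC /sc_arc /= !orbF.
  by rewrite -[(x * _)%g]invgK invMg invgK inLV orbb.
Qed.

Variables (n : nat) (Gn : #|gT| = n) (chi : 'I_n -> gT -> K[i]).
Hypothesis chiIrr : Irr_enum chi.

Notation projp i :=
  (herm2_projp (chisum (chi i) R) (chisum (chi i) L) (chisum (chi i) S)).
Notation projm i :=
  (herm2_projm (chisum (chi i) R) (chisum (chi i) L) (chisum (chi i) S)).
Notation lp i := (lambdap R L S (chi i)).
Notation lm i := (lambdam R L S (chi i)).

Let cR i : chisum (chi i) R \is Num.real.
Proof. by apply: chisum_real RV; exact: Irr_lin. Qed.
Let cL i : chisum (chi i) L \is Num.real.
Proof. by apply: chisum_real LV; exact: Irr_lin. Qed.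

Lemma lambdap_real i : lp i \is Num.real.
Proof. exact: herm2_eigp_real. Qed.
Lemma lambdam_real i : lm i \is Num.real.
Proof. exact: herm2_eigm_real. Qed.

(** Induction on [k]. The base case is column orthogonality, the projections adding up to the
    identity; in the step the adjacency matrix acts on each character through its block, and the
    projections are eigenvectors of that block. *)
Lemma adjmx_SC_exp k (x y : gT) (p q : 'I_2) :
  (adjmx K (SC R L S) ^+ k) (enum_rank (x, p)) (enum_rank (y, q)) =
  n%:R^-1 * \sum_i chi i (x * y^-1)%g *
    (projp i p q * lp i ^+ k + projm i p q * lm i ^+ k).
Proof.
elim: k x p => [|k IH] x p.
  rewrite expr0 mxE (inj_eq enum_rank_inj).
  under eq_bigr do rewrite !expr0 !mulr1 herm2_proj_sum //.
  rewrite -mulr_suml (Irr_column_orthogonality Gn chiIrr) mulrA.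
  rewrite mulKf ?(order_neq0 _ Gn) //.
  by rewrite xpair_eqE mulr_natr -mulnb natrM mulr_natr.
rewrite exprS mxE (reindex enum_rank) /=; last first.
  by apply: onW_bij; exact: enum_rank_bij.
transitivity (\sum_z \sum_o (SC R L S (x, p) (z, o))%:R *
    (adjmx K (SC R L S) ^+ k) (enum_rank (z, o)) (enum_rank (y, q))).
  by rewrite pair_bigA; apply: eq_bigr => -[z o] _; rewrite mxE !enum_rankK.
transitivity (\sum_z \sum_o \sum_i n%:R^-1 * ((SC R L S (x, p) (z, o))%:R *
    (chi i (z * y^-1)%g *
     (projp i o q * lp i ^+ k + projm i o q * lm i ^+ k)))).
  by do 2!apply: eq_bigr => ? _; rewrite IH mulrCA -!mulr_sumr.
under [LHS]eq_bigr do rewrite exchange_big.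
rewrite exchange_big mulr_sumr; apply: eq_bigr => i _ /=.
rewrite exchange_big /=.
under [LHS]eq_bigr do rewrite -mulr_sumr.
rewrite -mulr_sumr; congr (_ * _).
have fl := Irr_lin chiIrr i; have [_ fM] := fl.
transitivity (\sum_o (\sum_z (SC R L S (x, p) (z, o))%:R * chi i z) *
   (chi i y^-1%g * (projp i o q * lp i ^+ k + projm i o q * lm i ^+ k))).
  apply: eq_bigr => o _; rewrite mulr_suml; apply: eq_bigr => z _.
  by rewrite fM; ring.
under [LHS]eq_bigr do rewrite SC_character //.
transitivity (chi i x * chi i y^-1%g *
   ((\sum_o blk (chi i) p o * projp i o q) * lp i ^+ k +
    (\sum_o blk (chi i) p o * projm i o q) * lm i ^+ k)).
  rewrite !mulr_suml -big_split mulr_sumr; apply: eq_bigr => o _ /=; ring.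
rewrite herm2_mul_projp // herm2_mul_projm // fM !exprS.
rewrite -/(lambdap R L S (chi i)) -/(lambdam R L S (chi i)).
by congr (_ * (_ + _)); rewrite mulrAC mulrC.
Qed.

Lemma transition_SC t (x y : gT) (p q : 'I_2) :
  transition (SC R L S) t (enum_rank (x, p)) (enum_rank (y, q)) =
  n%:R^-1 * \sum_i chi i (x * y^-1)%g *
    herm2_fun (chisum (chi i) R) (chisum (chi i) L) (chisum (chi i) S)
      (expC (- 'i * lp i * t%:C)) (expC (- 'i * lm i * t%:C)) p q.
Proof.
(* The eigenvalues are indexed by a character and a sign, [true] standing for plus. *)
pose ev (l : 'I_n * bool) := if l.2 then lp l.1 else lm l.1.
pose co (l : 'I_n * bool) := n%:R^-1 * chi l.1 (x * y^-1)%g *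
  (if l.2 then projp l.1 p q else projm l.1 p q).
(* The eigenvalues are real, so each exponent is i times a real number, as [expmx_i_spectral]
   requires. *)
pose xi l := - (complex.Re (ev l) * t).
have evE l : 'i * (xi l)%:C = - 'i * ev l * t%:C.
  have evR : (complex.Re (ev l))%:C = ev l.
    by apply: RRe_real; rewrite /ev; case: l.2;
      [exact: lambdap_real | exact: lambdam_real].
  by rewrite -[in RHS]evR /xi rmorphN rmorphM; ring.
rewrite /transition (@expmx_i_spectral _ _ _ _ co xi) => [|k].
  transitivity (\sum_i \sum_b co (i, b) * expC ('i * (xi (i, b))%:C)).
    by rewrite pair_bigA; apply: eq_bigr => -[].
  rewrite mulr_sumr; apply: eq_bigr => i _.
  by rewrite big_bool /= !evE /co /ev /= /herm2_fun; ring.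
rewrite exprZmx mxE adjmx_SC_exp mulrCA !mulr_sumr.
transitivity (\sum_i \sum_b co (i, b) * ('i * (xi (i, b))%:C) ^+ k); last first.
  by rewrite pair_bigA; apply: eq_bigr => -[].
apply: eq_bigr => i _; rewrite big_bool /= !evE /co /ev /=.
by rewrite !exprMn; ring.
Qed.
End Transition.

(* The displacement is a = g h^-1, that is the inverse of g^-1 h: with g^-1 h
   the equivalence fails in the last two cases, for instance on Z/3 with
   R = L = set0, S = [set s], u = (1, 0), v = (s, 1) and t = pi / 2.  The first
   two cases are the same for a and its inverse. *)
Theorem lemma4p4 (K : realType) (gT : finGroupType) (n : nat)
    (Gab : abelian [set: gT]) (Gn : #|gT| = n)
    (R L S : {set gT}) (RV : R = (R^-1)%g) (LV : L = (L^-1)%g)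
    (RL1 : 1%g \notin R :|: L)
    (chi : 'I_n -> gT -> K[i]) (chiIrr : Irr_enum chi)
    (i1 : 'I_n) (chi1 : forall x, chi i1 x = 1)
    (g h : gT) (r s : 'I_2) (t : K) (t0 : 0 < t) :
  let X := [set i | chisum (chi i) S == 0]%SET in
  let a := (g * h^-1)%g in
  let lp i := lambdap R L S (chi i) in
  let lm i := lambdam R L S (chi i) in
  let E z := expC (- 'i * z * t%:C) in
  PST (SC R L S) (g, r) (h, s) t <->
  [\/ [/\ r = 0 /\ s = 0,
          forall i, chi i a = E (lp i1 - lp i) &
          forall j, j \notin X -> chi j a = E (lp i1 - lm j)],
      [/\ r = 1 /\ s = 1,
          forall i, chi i a = E (lm i1 - lm i) &
          forall j, j \notin X -> chi j a = E (lm i1 - lp j)],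
      [/\ r = 0 /\ s = 1, X = finset.set0,
          forall j,
            chi j a = `|chisum (chi j) S| / chisum (chi j) S
                      * E (lp i1 - lp j) /\
            E (lp j) = - E (lm j) &
          R = L] |
      [/\ r = 1 /\ s = 0, X = finset.set0,
          forall j,
            chi j a = `|chisum (chi j) S| / (chisum (chi j) S)^*
                      * E (lp i1 - lp j) /\
            E (lp j) = - E (lm j) &
          R = L]].
Proof.
move=> X a lp lm E.
have E0 z : E z != 0.
  apply/eqP => Ez; have := expC0 K.
  rewrite -(subrr (- 'i * z * t%:C)) expCD -/(E z) Ez mul0r => /esym/eqP.
  by rewrite oner_eq0.
have EB y z : E (y - z) = E y / E z.
  apply: (mulIf (E0 z)); rewrite mulfVK // -expCD; congr expC.
  by rewrite -mulrDl -mulrDr subrK.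
have E1 z : z \is Num.real -> `|E z| = 1.
  move=> /complex_realP[x ->]; apply: norm_expC.
  by rewrite -complexiE /=; ring.
have fl i := Irr_lin chiIrr i.
have cR i : chisum (chi i) R \is Num.real by exact: chisum_real.
have cL i : chisum (chi i) L \is Num.real by exact: chisum_real.
have p1 i : `|E (lp i)| = 1 by apply: E1; exact (lambdap_real S RV LV chiIrr i).
have m1 i : `|E (lm i)| = 1 by apply: E1; exact (lambdam_real S RV LV chiIrr i).
pose U i := herm2_fun (chisum (chi i) R) (chisum (chi i) L) (chisum (chi i) S)
  (E (lp i)) (E (lm i)).
(* A mean of numbers of the unit disk has modulus 1 iff they are all equal to
   one unit number; the value at i1 identifies it. *)
have PSTE : PST (SC R L S) (g, r) (h, s) t <->
    forall i, `|U i r s| = 1 /\ chi i a * U i r s = U i1 r s.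
  rewrite /PST (transition_SC S RV LV Gn chiIrr); split.
    move=> /norm_mean_eq1[i|w w1 Uw].
      rewrite normrM norm_lin_character // mul1r.
      exact: (norm_herm2_fun_le1 _ (cR i) (cL i) _ _ (p1 i) (m1 i)).
    have {}Uw i : chi i a * U i r s = w by exact: Uw.
    move=> i; split.
      by rewrite -w1 -(Uw i) normrM (norm_lin_character a (fl i)) mul1r.
    by rewrite -[U i1 r s]mul1r -(chi1 a) !Uw.
  move=> UE; rewrite (eq_bigr (fun=> U i1 r s)) => [|i _]; last exact: (UE i).2.
  rewrite sumr_const card_ord -[U i1 r s *+ n]mulr_natl mulKf.
    exact: (UE i1).1.
  exact: order_neq0 Gn.
have S1 : chisum (chi i1) S = #|S|%:R.
  by rewrite /chisum (eq_bigr (fun=> 1)) ?sumr_const.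
have inX i : (i \in X) = (chisum (chi i) S == 0) by rewrite inE.
have X0 : X = finset.set0 <-> forall i, chisum (chi i) S != 0.
  split=> [X0 i|X0]; first by rewrite -inX X0 inE.
  by apply/setP => i; rewrite inX inE (negbTE (X0 i)).
(* Cases (1) and (2) at once, for [p = 0] and [p = 1]. *)
have diag p : (forall i, `|U i p p| = 1 /\ chi i a * U i p p = U i1 p p) <->
    (forall i, chi i a = E ((if p == 0 then lp i1 else lm i1) -
                            (if p == 0 then lp i else lm i))) /\
    (forall i, i \notin X -> chi i a = E ((if p == 0 then lp i1 else lm i1) -
                            (if p == 0 then lm i else lp i))).
  split=> [H|[H1 H2]].
    have pm i : chisum (chi i) S != 0 -> E (lp i) = E (lm i).
      by have [/(norm_herm2_fun_diagP _ (cR i) (cL i) (p1 i) (m1 i))] := H i.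
    have UE i : U i p p = E (if p == 0 then lp i else lm i).
      by rewrite /U herm2_fun_diagE //; [case: ifP | exact: pm].
    have H1 i : chi i a = E ((if p == 0 then lp i1 else lm i1) -
                            (if p == 0 then lp i else lm i)).
      by rewrite EB -!UE -(H i).2 mulfK // UE.
    split=> // i; rewrite inX => /pm epm; rewrite H1 !EB; congr (_ / _).
    by case: ifP.
  (* Outside [X] the two hypotheses give two expressions for [chi i a]; comparing them equates the
     exponentials. *)
  have pm i : chisum (chi i) S != 0 -> E (lp i) = E (lm i).
    rewrite -inX => iX; have := H1 i; rewrite (H2 i iX) !EB.
    by move=> /(mulfI (E0 _))/invr_inj; case: ifP.
  have UE i : U i p p = E (if p == 0 then lp i else lm i).
    by rewrite /U herm2_fun_diagE //; [case: ifP | exact: pm].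
  move=> i; split; last by rewrite !UE H1 EB mulfVK.
  by rewrite UE; case: ifP.
(* Cases (3) and (4) at once: [c i] is the sum over [S] for layers (0, 1) and its conjugate for (1,
   0). *)
have off p q (c := fun i => herm2 (chisum (chi i) R) (chisum (chi i) L)
    (chisum (chi i) S) p q) : p != q ->
  (forall i, `|U i p q| = 1 /\ chi i a * U i p q = U i1 p q) <->
  [/\ X = finset.set0,
      forall j, chi j a = `|chisum (chi j) S| / c j * E (lp i1 - lp j) /\
                E (lp j) = - E (lm j) &
      R = L].
  move=> pq.
  have c0 i : chisum (chi i) S != 0 -> c i != 0.
    by move=> S0; rewrite -normr_eq0 norm_herm2_offdiag // normr_eq0.
  (* For the trivial character the sum over [S] is the cardinal of [S], so its phase is 1 and drops
     out. *)
  have c1 : chisum (chi i1) S != 0 -> c i1 / `|chisum (chi i1) S| = 1.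
    rewrite S1 /c /herm2 S1 normr_nat conjC_nat => S0.
    by case: (ord2_case p) pq => ->; case: (ord2_case q) => ->; rewrite ?divff.
  split=> [H|[/X0 S0 H RL]].
    have Hi i : [/\ chisum (chi i) S != 0, chisum (chi i) R = chisum (chi i) L &
        E (lp i) = - E (lm i)].
      by have [/(norm_herm2_fun_offdiagP _ (cR i) (cL i) (p1 i) (m1 i) pq)] :=
        H i.
    split; [by apply/X0 => i; case: (Hi i) | | ].
      move=> j; have [S0 RL epm] := Hi j; split=> //.
      have [S1' RL1' epm1] := Hi i1.
      have := (H j).2; rewrite /U !herm2_fun_offdiagE // -!/(c _).
      rewrite c1 // mul1r EB => <-.
      have := E0 (lp j); have := c0 j S0; have : `|chisum (chi j) S| != 0.
        by rewrite normr_eq0.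
      by move=> ? ? ?; field; apply/and3P.
    by apply: (chisum_inj Gn chiIrr) => i; case: (Hi i).
  have RL' i : chisum (chi i) R = chisum (chi i) L by rewrite RL.
  move=> i; split.
    by apply/norm_herm2_fun_offdiagP => //; split=> //; exact: (H i).2.
  rewrite /U !herm2_fun_offdiagE //; try exact: (H _).2.
  rewrite -!/(c _) c1 // mul1r (H i).1 EB.
  have := E0 (lp i); have := c0 i (S0 i); have : `|chisum (chi i) S| != 0.
    by rewrite normr_eq0.
  by move=> ? ? ?; field; apply/and3P.
rewrite PSTE; have [-> | ->] := ord2_case r; have [-> | ->] := ord2_case s.
- rewrite diag /=; split=> [[H1 H2] | [[_ H1 H2]|[[]]|[[]]|[[]]] //].
  by apply: Or41; split.
- rewrite off //; split=> [[H1 H2 H3] | [[[]]|[[]]|[_ H1 H2 H3]|[[]]] //].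
  by apply: Or43; split.
- rewrite off //; split=> [[H1 H2 H3] | [[[]]|[[]]|[[]]|[_ H1 H2 H3]] //].
  by apply: Or44; split.
- rewrite diag /=; split=> [[H1 H2] | [[[]]|[_ H1 H2]|[[]]|[[]]] //].
  by apply: Or42; split.
Qed.
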